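(* Let $R$ be a commutative unital ring and let $I$ be a proper ideal of $R$ which is not maximal. The following statements are equivalent: (1) $I$ is a quasi-maximal ideal of $R$. (2) $I$ is submaximal. (3) Every proper ideal of $R$ strictly containing $I$ is a maximal ideal (that is, $I$ is strictly contained only in maximal ideals).
   Context: A proper ideal $I$ of a ring $R$ is quasi-maximal if for every $a\in R\setminus I$, either $I+Ra=R$ or $I+Ra$ is a maximal ideal of $R$. For ideals $I,J$ of $R$, $J$ covers $I$ (written $I\prec J$) if $I\subsetneq J$ and there is no ideal of $R$ strictly between $I$ and $J$. An ideal $I$ is submaximal if there is a maximal ideal $M$ of $R$ with $I\prec M$. *)

(* Defs.v *)
From HB Require Import structures.
From mathcomp Require Import all_boot all_order all_algebra.
From mathcomp Require Import boolp classical_sets.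

Set Implicit Arguments.
Unset Strict Implicit.
Unset Printing Implicit Defensive.

Import GRing.Theory.
Local Open Scope classical_set_scope.
Local Open Scope ring_scope.

(* [comPzRingType], unlike [comNzRingType], allows the zero ring. *)

Section Ideals.
Variable R : comPzRingType.
Implicit Types (I J K M : set R) (a r x y : R).

(* [idealr] is not used: it is restricted to proper ideals of nontrivial rings;
   see [proper_idealE] for the comparison. *)
Definition ideal I : Prop :=
  [/\ I 0,
      forall x y, I x -> I y -> I (x + y) &
      forall r x, I x -> I (r * x)].

Definition is_proper_ideal I : Prop := ideal I /\ I <> setT.

Definition maximal_ideal M : Prop :=
  is_proper_ideal M /\ forall J, is_proper_ideal J -> M `<=` J -> J = M.

Definition principal a : set R := [set r * a | r in setT].

Definition ideal_add I J : set R := [set x + y | x in I & y in J].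

Definition quasi_maximal I : Prop :=
  is_proper_ideal I /\
  forall a, ~ I a ->
    ideal_add I (principal a) = setT \/ maximal_ideal (ideal_add I (principal a)).

Definition covers I J : Prop :=
  [/\ ideal I, ideal J, I `<` J &
      ~ exists K, [/\ ideal K, I `<` K & K `<` J]].

Definition submaximal I : Prop := exists M, maximal_ideal M /\ covers I M.

Lemma ideal_principal a : ideal (principal a).
Proof.
split=> [|_ _ [r _ <-] [s _ <-]|r _ [s _ <-]]; first by exists 0; rewrite ?mul0r.
- by exists (r + s); rewrite ?mulrDl.
- by exists (r * s); rewrite ?mulrA.
Qed.

Lemma ideal_ideal_add I J : ideal I -> ideal J -> ideal (ideal_add I J).
Proof.
move=> [I0 ID IM] [J0 JD JM]; split.
- by exists 0 => //; exists 0; rewrite ?addr0.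
- move=> _ _ [x Ix [y Jy <-]] [u Iu [v Jv <-]].
  by exists (x + u); [exact: ID|exists (y + v); [exact: JD|rewrite addrACA]].
- move=> r _ [x Ix [y Jy <-]].
  by exists (r * x); [exact: IM|exists (r * y); [exact: JM|rewrite mulrDr]].
Qed.

Lemma ideal_neqT I : ideal I -> (I <> setT <-> ~ I 1).
Proof.
move=> [_ _ IM]; split=> [IT I1|I1 IT]; last by apply: I1; rewrite IT.
by apply: IT; apply/seteqP; split=> // x _; rewrite -[x]mulr1; exact: IM.
Qed.

End Ideals.

Lemma proper_idealE (R : comNzRingType) (I : set R) :
  is_proper_ideal I <-> idealr_closed (mem I).
Proof.
split=> [[iI /(ideal_neqT iI) I1]|[/set_mem I0 I1 IDM]].
  case: (iI) => I0 ID IM; split; [exact/mem_set|by apply/negP => /set_mem|].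
  move=> a x y /set_mem Ix /set_mem Iy; apply/mem_set; apply: ID => //.
  exact: IM.
have iI : ideal I.
  split=> // [x y|r x] Ix *.
    by rewrite -[x]mul1r; apply: set_mem; apply: IDM; exact/mem_set.
  by rewrite -[_ * _]addr0; apply: set_mem; apply: IDM; exact/mem_set.
split=> //; apply/(ideal_neqT iI) => I1'; move/negP: I1; apply; exact/mem_set.
Qed.

(* Main.v *)
Require Import Defs.
From mathcomp Require Import all_boot all_order all_algebra.
From mathcomp Require Import boolp classical_sets.
Local Open Scope classical_set_scope.
Local Open Scope ring_scope.

(** The substance is the implication from submaximal to being strictly contained
    only in maximal ideals. Let [I] be covered by the maximal ideal [M]. A proper
    ideal [K] containing [I] either equals [M] or meets [M] exactly in [I], since
    [K `&` M] lies between [I] and [M] ([covered_proper_ideal]). If [J] strictly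
    contains [I] and is not [M], then [J] is not contained in [M], so [M + J] is
    the whole ring; writing [1 = m + j], every [k] in a proper [K] containing [J]
    is [k * m + k * j], with [k * m] in [K `&` M = I]. Hence [K] is contained in
    [J] ([covers_maximal_up]). This is the modular law for ideals.

    For the other two implications, an ideal strictly containing [I] contains
    some [I + R a] with [a] outside [I]. So quasi-maximality controls all
    ideals strictly above [I]: in a proper one it finds a maximal ideal
    [I + R a], which has to cover [I] ([quasi_maximal_submaximal]). Conversely
    each [I + R a] strictly contains [I]. *)

Import GRing.Theory.

Section SubmaximalIdeals.
Set Implicit Arguments.
Unset Strict Implicit.
Context {R : comPzRingType}.
Implicit Types (I J K M : set R) (a x y : R).

Lemma ideal_setI I J : ideal I -> ideal J -> ideal (I `&` J).
Proof.
move=> [I0 ID IM] [J0 JD JM]; split=> //.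
- by move=> x y [Ix Jx] [Iy Jy]; split; [exact: ID|exact: JD].
- by move=> r x [Ix Jx]; split; [exact: IM|exact: JM].
Qed.

Lemma sub_ideal_addl I J : ideal J -> I `<=` ideal_add I J.
Proof. by move=> [J0 _ _] x Ix; exists x => //; exists 0; rewrite ?addr0. Qed.

Lemma sub_ideal_addr I J : ideal I -> J `<=` ideal_add I J.
Proof. by move=> [I0 _ _] x Jx; exists 0 => //; exists x; rewrite ?add0r. Qed.

Lemma ideal_add_sub I J K :
  ideal K -> I `<=` K -> J `<=` K -> ideal_add I J `<=` K.
Proof. by move=> [_ KD _] IK JK _ [x Ix [y Jy <-]]; apply: KD; auto. Qed.

Lemma principal_sub a K : ideal K -> K a -> principal a `<=` K.
Proof. by move=> [_ _ KM] Ka _ [r _ <-]; exact: KM. Qed.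

Lemma ideal_add_principal_proper I a :
  ideal I -> ~ I a -> I `<` ideal_add I (principal a).
Proof.
move=> iI nIa; split; first exact/sub_ideal_addl/ideal_principal.
by apply: contra_not nIa; apply; apply: sub_ideal_addr => //; exists 1; rewrite ?mul1r.
Qed.

Lemma sub_is_proper_ideal J K :
  ideal J -> is_proper_ideal K -> J `<=` K -> is_proper_ideal J.
Proof.
move=> iJ [iK /(ideal_neqT iK) K1] JK; split=> //.
by apply/(ideal_neqT iJ) => /JK.
Qed.

Lemma maximal_ideal_addT M J :
  maximal_ideal M -> ideal J -> ~ J `<=` M -> ideal_add M J = setT.
Proof.
move=> [[iM _] maxM] iJ nJM; apply: contrapT => nT.
apply: nJM; rewrite -[X in _ `<=` X](maxM (ideal_add M J)).
- exact: sub_ideal_addr.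
- by split=> //; exact: ideal_ideal_add.
- exact: sub_ideal_addl.
Qed.

Lemma not_maximal_proper_above I :
  is_proper_ideal I -> ~ maximal_ideal I -> exists2 J, is_proper_ideal J & I `<` J.
Proof.
move=> pI nmI; apply: contrapT => none; apply: nmI; split=> // J pJ IJ.
apply/seteqP; split=> //; apply: contrapT => nJI.
by apply: none; exists J.
Qed.

(** Below a proper ideal strictly above [I], every element outside [I] gives a
    proper, hence maximal, ideal [I + R a]. *)
Lemma quasi_maximal_below I J : quasi_maximal I -> is_proper_ideal J -> I `<` J ->
  exists2 M, maximal_ideal M & I `<` M /\ M `<=` J.
Proof.
move=> [[iI _] qI] [iJ JT] [IJ nJI].
have [a [Ja nIa]] : exists a, J a /\ ~ I a.
  apply: contrapT => none; apply: nJI => x Jx.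
  by apply: contrapT => nIx; apply: none; exists x.
have IaJ : ideal_add I (principal a) `<=` J.
  by apply: ideal_add_sub => //; exact: principal_sub.
exists (ideal_add I (principal a)); last first.
  by split=> //; exact: ideal_add_principal_proper.
case: (qI a nIa) => // IaT; exfalso; apply: JT.
by apply/seteqP; split=> //; rewrite -IaT.
Qed.

(** An ideal strictly between [I] and a maximal [M] would contain a second
    maximal ideal, which maximality forces to equal [M]. *)
Lemma quasi_maximal_submaximal I :
  quasi_maximal I -> ~ maximal_ideal I -> submaximal I.
Proof.
move=> qI nmI; have [J pJ IJ] := not_maximal_proper_above (proj1 qI) nmI.
have [M mM [IM _]] := quasi_maximal_below qI pJ IJ.
have pM := proj1 mM.
exists M; split=> //; split=> //; [exact: (proj1 (proj1 qI))|exact: (proj1 pM)|].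
move=> [K [iK IK [KM nMK]]]; apply: nMK.
have [N mN [_ NK]] := quasi_maximal_below qI (sub_is_proper_ideal iK pM KM) IK.
by rewrite (proj2 mN M pM (subset_trans NK KM)).
Qed.

Lemma covered_proper_ideal I M K : maximal_ideal M -> covers I M ->
  is_proper_ideal K -> I `<=` K -> K = M \/ K `&` M = I.
Proof.
move=> [_ maxM] [_ iM [IM _] noK] pK IK.
have [MK|nMK] := pselect (M `<=` K); first by left; exact: maxM.
right; apply: contrapT => neI; apply: noK; exists (K `&` M).
have IKM : I `<=` K `&` M by move=> x Ix; split; auto.
split; first exact: (ideal_setI (proj1 pK) iM).
- by split=> // KMI; apply: neI; apply/seteqP.
- by split=> [x []//|MKM]; apply: nMK => x /MKM [].
Qed.

(** The modular law: an ideal [K] above [J] with the same trace [I] on [M] as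
    [J], where [M + J] is everything, must equal [J]. *)
Lemma covers_maximal_up I M J : maximal_ideal M -> covers I M ->
  is_proper_ideal J -> I `<` J -> maximal_ideal J.
Proof.
move=> mM cIM pJ [IJ nJI].
have [->//|JMI] := covered_proper_ideal mM cIM pJ IJ.
have nJM : ~ J `<=` M.
  by move=> JM; apply: nJI; rewrite -[X in _ `<=` X]JMI => x Jx; split; auto.
have [iJ _] := pJ; have [_ JD JMul] := iJ.
split=> // K pK JK; apply/seteqP; split=> // k Kk.
have [KM|KMI] := covered_proper_ideal mM cIM pK (subset_trans IJ JK).
  by case: nJM; rewrite -KM.
have [_ _ KMul] := proj1 pK; have [_ _ MMul] := proj1 (proj1 mM).
have : ideal_add M J 1 by rewrite (maximal_ideal_addT mM iJ nJM).
move=> [m Mm [j Jj mj1]].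
rewrite -[k]mulr1 -mj1 mulrDr; apply: JD; last exact: JMul.
apply: IJ; rewrite -KMI; split; last exact: MMul.
by rewrite mulrC; exact: KMul.
Qed.

Lemma quasi_maximal_of_maximal_above I : is_proper_ideal I ->
  (forall J, is_proper_ideal J -> I `<` J -> maximal_ideal J) -> quasi_maximal I.
Proof.
move=> pI up; split=> // a nIa; have [iI _] := pI.
have [|nT] := pselect (ideal_add I (principal a) = setT); [by left|right].
apply: up; last exact: ideal_add_principal_proper.
by split=> //; apply: ideal_ideal_add => //; exact: ideal_principal.
Qed.

End SubmaximalIdeals.

Theorem theorem2p6 (R : comPzRingType) (I : set R)
    (I_proper : is_proper_ideal I) (I_not_maximal : ~ maximal_ideal I) :
  [<-> quasi_maximal I;
       submaximal I;
       forall J : set R, is_proper_ideal J -> I `<` J -> maximal_ideal J].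
Proof.
tfae.
- by move=> qI; exact: quasi_maximal_submaximal.
- by move=> [M [mM cIM]] J; exact: (covers_maximal_up mM cIM).
- exact: quasi_maximal_of_maximal_above.
Qed.
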